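(* Let $r\in\mathbb{N}=\{0,1,2,\dots\}$, $p=2^r$. Suppose that $\gamma>1$ satisfies $\overline g_{k-1,k}(x)\le\gamma$ for all $x\in E$ and $1\le k\le n$, and that $\alpha\in(0,1)$ and $\beta\in[0,1]$ satisfy, for all $2\le k\le n$ and $f\in B(E)$, $$\|\hat q_{k-1,k}(f)\|_{L_2(\mu_{k-1})}^2\le\alpha\|f\|_{L_2(\mu_k)}^2+\beta\,\mu_k(f)^2 .$$ Assume that $\alpha\gamma^{p-2}<1$. Then for all $1\le j<k\le n$ and $f\in B(E)$, $$\|\hat q_{j,k}(f)\|_{L_p(\mu_j)}\le\delta(p)\,\|f\|_{L_p(\mu_k)}$$ with $$\delta(p)=\prod_{i=1}^r\frac{\gamma^{1-2^{-(i-1)}}}{(1-\alpha\gamma^{2^i-2})^{2^{-i}}}<\frac{\gamma^{r-2+2^{-(r-1)}}}{1-\alpha\gamma^{2^r-2}}$$ (an empty product being $1$).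
   Context: $E$ is a Polish space, $B(E)$ the bounded measurable real functions on $E$, $\mu(f)=\int f\,d\mu$, $\|f\|_{L_p(\mu)}=\mu(|f|^p)^{1/p}$, and $K(f)(x)=\int f(z)K(x,dz)$ for a kernel $K$. $\mu_0,\dots,\mu_n$ are probability measures on $E$; for $1\le k\le n$, $K_k$ is a Markov transition kernel on $E$ with stationary distribution $\mu_k$ ($\mu_kK_k=\mu_k$), and $g_{k-1,k}\in B(E)$ is positive with $\mu_k(f)=\mu_{k-1}(g_{k-1,k}f)/\mu_{k-1}(g_{k-1,k})$ for all $f\in B(E)$. Put $\overline g_{k-1,k}=g_{k-1,k}/\mu_{k-1}(g_{k-1,k})$. Modified propagator: $\hat q_{k-1,k}(f)=K_{k-1}(\overline g_{k-1,k}f)$ for $2\le k\le n$ and $f\in B(E)$; $\hat q_{j,k}=\hat q_{j,j+1}\circ\cdots\circ\hat q_{k-1,k}$ for $1\le j<k\le n$; $\hat q_{k,k}(f)=f$. *)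

(* Defs.v *)
From HB Require Import structures.
From mathcomp Require Import all_boot all_order all_algebra.
From mathcomp Require Import all_classical all_reals all_analysis.

Set Implicit Arguments.
Unset Strict Implicit.
Unset Printing Implicit Defensive.

Import Order.TTheory GRing.Theory Num.Theory.
Import numFieldNormedType.Exports.

Local Open Scope classical_set_scope.
Local Open Scope ring_scope.

Definition completely_metrizable (R : realType) (T : topologicalType) : Prop :=
  exists dist : T -> T -> R,
    [/\ [/\ forall x y, dist x y = 0 <-> x = y,
            forall x y, dist x y = dist y x &
            forall x y z, dist x z <= dist x y + dist y z],
        forall A : set T, open A <->
          (forall x, A x ->
             exists2 e : R, 0 < e & [set y | dist x y < e] `<=` A) &
        forall u : nat -> T,
          (forall e : R, 0 < e -> exists N : nat, forall m n : nat,
             (N <= m)%N -> (N <= n)%N -> dist (u m) (u n) < e) ->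
          exists l : T, u @ \oo --> l].

Definition polish (R : realType) (T : topologicalType) : Prop :=
  completely_metrizable R T /\ (exists2 D : set T, countable D & dense D).

(* Measurable types are pointed in the library, hence [E : ptopologicalType];
   this only excludes the empty space, on which there is no probability. *)
Notation borelType E := (g_sigma_algebraType (@open E)).

Definition bounded_measurable (d : measure_display) (E : measurableType d)
    (R : realType) (f : E -> R) : Prop :=
  measurable_fun [set: E] f /\ (exists M : R, forall x, `|f x| <= M).

Definition stationary (d : measure_display) (E : measurableType d)
    (R : realType) (mu : probability E R) (K : R.-pker E ~> E) : Prop :=
  forall A : set E, measurable A -> (\int[mu]_x K x A = mu A)%E.

Definition kernel_fun (d : measure_display) (E : measurableType d)
    (R : realType) (K : R.-pker E ~> E) (f : E -> R) : E -> R :=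
  fun x => \int[K x]_z f z.

Section Propagator.
Context {d : measure_display} {E : measurableType d} {R : realType}.
Variables (mu : nat -> probability E R) (K : nat -> R.-pker E ~> E).
(* [g k] is $g_{k-1,k}$, so only the values for [k >= 1] are meaningful *)
Variable g : nat -> E -> R.

Definition gbar (k : nat) (x : E) : R :=
  g k x / \int[mu k.-1]_y g k y.

(* $\hat q_{k-1,k}$, meaningful for [k >= 2] *)
Definition qhat_step (k : nat) (f : E -> R) : E -> R :=
  kernel_fun (K k.-1) (fun z => gbar k z * f z).

(* the factors [j <= i < k] are composed in increasing order, so this is
   $\hat q_{j,j+1} \circ \dots \circ \hat q_{k-1,k}$, and the identity if
   [j = k] *)
Definition qhat (j k : nat) : (E -> R) -> (E -> R) :=
  \big[(fun u v : (E -> R) -> (E -> R) => u \o v)/idfun]_(j <= i < k)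
    qhat_step i.+1.

End Propagator.

(* $\delta(2^r)$ *)
Definition delta (R : realType) (alpha gamma : R) (r : nat) : R :=
  \prod_(1 <= i < r.+1)
    (gamma `^ (1 - 2 `^ (- (i%:R - 1)))
     / (1 - alpha * gamma `^ (2 ^+ i - 2)) `^ (2 `^ (- i%:R))).

(* Main.v *)
(** Write $p = 2^i$ and $q$ for one step of the propagator. Jensen's inequality
    for the kernel and $\overline g \le \gamma$ give
    $|q(f)|^p \le \gamma^{p-1} q(|f|^p)$. Squaring, integrating and applying the
    $L_2$ hypothesis to $|f|^p$ yields
    $\|q(f)\|_{2p}^{2p} \le
     \gamma^{2p-2} (\alpha \|f\|_{2p}^{2p} + \|f\|_p^{2p})$.
    The $L_p$ bound with constant $D = \delta(p)^p$ therefore propagates, by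
    backward induction on $j$, to an $L_{2p}$ bound whose constant is the fixed
    point $D' = D^2 \gamma^{2p-2} / (1 - \alpha \gamma^{2p-2})$ of
    $D' = \gamma^{2p-2} (\alpha D' + D^2)$, which is $\delta(2p)^{2p}$. For
    $p = 1$, stationarity makes $q$ an $L_1$ contraction. *)

Require Import Defs.
From HB Require Import structures.
From mathcomp Require Import all_boot all_order all_algebra.
From mathcomp Require Import all_classical all_reals all_analysis.
From mathcomp Require Import ring lra.
From mathcomp Require Import measurable_realfun giry.

Set Implicit Arguments.
Unset Strict Implicit.
Unset Printing Implicit Defensive.

Import Order.TTheory GRing.Theory Num.Theory.
Import numFieldNormedType.Exports.

Local Open Scope classical_set_scope.
Local Open Scope ring_scope.

(** * Integrals of bounded measurable functions: Jensen for powers of two, and $L_p$ norms *)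

Section BoundedMeasurable.
Context {d : measure_display} {E : measurableType d} {R : realType}.
Implicit Types (P : {measure set E -> \bar R}) (f g : E -> R).

Lemma bounded_measurable_cst (c : R) :
  bounded_measurable (fun _ : E => c).
Proof. by split; [exact: measurable_cst|exists `|c|]. Qed.

Lemma bounded_measurableD f g : bounded_measurable f -> bounded_measurable g ->
  bounded_measurable (fun x => f x + g x).
Proof.
move=> [mf [M hM]] [mg [N hN]]; split; first exact: measurable_funD.
by exists (M + N) => x; rewrite (le_trans (ler_normD _ _))// lerD.
Qed.

Lemma bounded_measurableM f g : bounded_measurable f -> bounded_measurable g ->
  bounded_measurable (fun x => f x * g x).
Proof.
move=> [mf [M hM]] [mg [N hN]]; split; first exact: measurable_funM.
by exists (M * N) => x; rewrite normrM ler_pM.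
Qed.

Lemma bounded_measurable_normX f m : bounded_measurable f ->
  bounded_measurable (fun x => `|f x| ^+ m).
Proof.
move=> [mf [M hM]]; split.
  by apply: measurable_funX; exact: measurableT_comp.
by exists (M ^+ m) => x; rewrite normrX normr_id lerXn2r// nnegrE (le_trans _ (hM x)).
Qed.

Lemma bounded_measurable_integrable P f : P setT = 1%E -> bounded_measurable f ->
  P.-integrable setT (EFin \o f).
Proof.
move=> P1 [mf [M hM]]; apply: measurable_bounded_integrable => //.
  by rewrite P1 ltry.
exists M; split; first exact: num_real.
by move=> N MN x _ /=; apply: le_trans (hM x) _; exact: ltW.
Qed.

(** Nonnegativity of the variance: $\int (f-c)^2 \ge 0$ is expanded with $c$ the mean of $f$. *)
Lemma sqr_Rintegral_le P f : P setT = 1%E -> bounded_measurable f ->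
  (\int[P]_x f x) ^+ 2 <= \int[P]_x (f x ^+ 2).
Proof.
move=> P1 bf; set c := \int[P]_x f x.
have bff : bounded_measurable (fun x => f x * f x) by exact: bounded_measurableM.
have bcf : bounded_measurable (fun x => - (2 * c) * f x).
  exact: bounded_measurableM (bounded_measurable_cst _) bf.
have bs := bounded_measurableD bcf (bounded_measurable_cst (c ^+ 2)).
have : 0 <= \int[P]_x ((f x - c) ^+ 2) by apply: Rintegral_ge0 => x _; exact: sqr_ge0.
rewrite (_ : (fun x => (f x - c) ^+ 2) =
    (fun x => f x * f x + (- (2 * c) * f x + c ^+ 2))); last first.
  by apply/funext => x; ring.
rewrite RintegralD//; last 2 first.
- exact: bounded_measurable_integrable P1 bff.
- exact: bounded_measurable_integrable P1 bs.
rewrite RintegralD//; last 2 first.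
- exact: bounded_measurable_integrable P1 bcf.
- exact: bounded_measurable_integrable P1 (bounded_measurable_cst _).
rewrite RintegralZl//; last exact: bounded_measurable_integrable.
rewrite Rintegral_cst// P1 /= mulr1 -/c => h.
under eq_Rintegral do rewrite expr2.
by rewrite -subr_ge0 (le_trans h)// le_eqVlt; apply/orP; left; apply/eqP; ring.
Qed.

(* Jensen, obtained by iterating the variance bound *)
Lemma normX_Rintegral_le P f i : P setT = 1%E -> bounded_measurable f ->
  `|\int[P]_x f x| ^+ (2 ^ i)%N <= \int[P]_x (`|f x| ^+ (2 ^ i)%N).
Proof.
move=> P1 bf; elim: i => [|i IH].
  by apply: le_normr_Rintegral => //; exact: bounded_measurable_integrable.
rewrite expnSr exprM; under [leRHS]eq_Rintegral do rewrite exprM.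
apply: le_trans (sqr_Rintegral_le P1 (bounded_measurable_normX _ bf)).
by rewrite lerXn2r// nnegrE ?exprn_ge0// Rintegral_ge0// => x _; rewrite exprn_ge0.
Qed.

(** Boundedness makes the integral finite. This bridge lets all the estimates be carried out on real
    integrals; extended norms return only at the end. *)
Lemma LnormX P f p : (0 < p)%N -> P setT = 1%E -> bounded_measurable f ->
  ('N[P]_(p%:R)%:E[EFin \o f] =
    ((\int[P]_x (`|f x| ^+ p)) `^ p%:R^-1)%R%:E)%E.
Proof.
move=> p0 P1 bf; rewrite unlock /= -poweR_EFin; congr (_ `^ _)%E.
rewrite /Rintegral fineK; last first.
  apply: integrable_fin_num => //.
  exact: bounded_measurable_integrable (bounded_measurable_normX _ _).
by apply: eq_integral => x _; rewrite /= powR_mulrn.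
Qed.

Lemma Lnorm2_sqr P f : P setT = 1%E -> bounded_measurable f ->
  ('N[P]_2%:E[EFin \o f] ^+ 2 = (\int[P]_x (`|f x| ^+ 2))%:E)%E.
Proof.
move=> P1 bf; rewrite (@LnormX P f 2)// -EFin_expe -powR_mulrn ?powR_ge0// -powRrM.
rewrite mulVf// powRr1// Rintegral_ge0// => x _; exact: exprn_ge0.
Qed.

End BoundedMeasurable.

(** * Action of a Markov kernel on functions, and invariance of integrals under stationarity *)

Section Kernel.
Context {d : measure_display} {E : measurableType d} {R : realType}.
Implicit Types (mu : probability E R) (K : R.-pker E ~> E) (f : E -> R).

(* [K x] bundled as a probability, hence as a point of the Giry monad *)
Definition kernel_law K (x : E) : set E -> \bar R := K x.

HB.instance Definition _ K x := Measure.on (kernel_law K x).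
HB.instance Definition _ K x :=
  Measure_isProbability.Build _ _ _ (kernel_law K x) (prob_kernel x).

Lemma measurable_kernel_law K :
  measurable_fun setT (kernel_law K : E -> giry E R).
Proof.
apply: measurable_giry_codensity => // B mB; exact: measurable_kernel.
Qed.

(** The iterated integral is the integral of [h] against the Giry bind of [mu] and [K], that is, the
    measure $\mu K$; stationarity identifies it with [mu] on every measurable set. *)
Lemma ge0_integral_stationary mu K (h : E -> \bar R) : stationary mu K ->
  measurable_fun setT h -> (forall x, 0 <= h x)%E ->
  (\int[mu]_x \int[K x]_z h z = \int[mu]_x h x)%E.
Proof.
move=> hK mh h0; have := giry_int_bind mu (measurable_kernel_law K) mh h0.
rewrite /giry_int => <-; apply: eq_measure_integral => A mA _.
rewrite -[RHS](hK A mA).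
apply: (giry_int_map (measurable_kernel_law K) mu (measurable_giry_ev mA)).
by move=> nu; exact: measure_ge0.
Qed.

(** Used with [c] a bound of [f], so that results on nonnegative functions reach signed bounded
    ones. *)
Lemma kernel_fun_addr K f c : bounded_measurable f ->
  kernel_fun K (fun z => f z + c) = fun x => kernel_fun K f x + c.
Proof.
move=> bf; apply/funext => x; rewrite /kernel_fun RintegralD//; last 2 first.
- exact: bounded_measurable_integrable (prob_kernel x) bf.
- exact: bounded_measurable_integrable (prob_kernel x) (bounded_measurable_cst _).
by rewrite Rintegral_cst// prob_kernel mulr1.
Qed.

Lemma bounded_measurable_kernel_fun K f : bounded_measurable f ->
  bounded_measurable (kernel_fun K f).
Proof.
move=> bf; have [mf [M hM]] := bf; split; last first.
  exists M => x; rewrite /kernel_fun.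
  have bn := bounded_measurable_normX 1 bf.
  apply: le_trans (le_normr_Rintegral _ _) _ => //.
    exact: bounded_measurable_integrable (prob_kernel x) bf.
  apply: le_trans (_ : \int[K x]_z M <= _); last first.
    by rewrite Rintegral_cst// prob_kernel mulr1.
  apply: le_Rintegral => //.
    exact: bounded_measurable_integrable (prob_kernel x) bn.
  exact: bounded_measurable_integrable (prob_kernel x) (bounded_measurable_cst _).
(* Measurability of kernel integrals is available for nonnegative integrands, hence the shift by the
   bound [M]. *)
have -> : kernel_fun K f = fun x => kernel_fun K (fun z => f z + M) x - M.
  by apply/funext => x; rewrite kernel_fun_addr// addrK.
apply: measurable_funB => //; apply: measurableT_comp => //.
apply: measurable_fun_integral_kernel => [U mU|z|].
- exact: measurable_kernel.
- by rewrite lee_fin -lerBlDr sub0r; have := hM z; rewrite ler_norml => /andP[].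
- by apply/measurable_EFinP; exact: measurable_funD.
Qed.

Lemma Rintegral_stationary mu K f : stationary mu K -> bounded_measurable f ->
  \int[mu]_x kernel_fun K f x = \int[mu]_x f x.
Proof.
move=> hK bf; have [mf [M hM]] := bf.
have bM := @bounded_measurable_cst _ E R M.
have mu1 := probability_setT mu.
have bint h : bounded_measurable h -> mu.-integrable setT (EFin \o h).
  exact: bounded_measurable_integrable.
(* The same shift: adding the integral of [M] to both sides replaces [f] by $f+M \ge 0$. *)
apply: (@addIr _ (\int[mu]_x M)).
rewrite -RintegralD ?bint//; last exact: bounded_measurable_kernel_fun.
rewrite -RintegralD ?bint//.
rewrite (_ : (fun x => kernel_fun K f x + M) = kernel_fun K (fun z => f z + M)).
  rewrite {1 2}/Rintegral -[in RHS](@ge0_integral_stationary mu K _ hK); last 2 first.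
  - by apply/measurable_EFinP; exact: measurable_funD.
  - move=> z; rewrite lee_fin -lerBlDr sub0r; have := hM z.
    by rewrite ler_norml => /andP[].
  congr fine; apply: eq_integral => x _; rewrite /kernel_fun /Rintegral fineK//.
  apply: integrable_fin_num => //.
  exact: bounded_measurable_integrable (prob_kernel x) (bounded_measurableD bf bM).
by rewrite kernel_fun_addr.
Qed.

End Kernel.

(** * One step of the propagator, with [mu], [nu], [h] in the roles of $\mu_{k-1}$, $\mu_k$,
    $\overline g_{k-1,k}$ *)

Section PropagatorStep.
Context {d : measure_display} {E : measurableType d} {R : realType}.
Variables (mu nu : probability E R) (K : R.-pker E ~> E) (h : E -> R).
Variables (alpha beta gamma : R).
Hypotheses (hK : stationary mu K) (bh : bounded_measurable h).
Hypothesis h_itv : forall x, 0 <= h x <= gamma.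
Hypothesis hnu : forall f, bounded_measurable f ->
  \int[mu]_x (h x * f x) = \int[nu]_x f x.

Let q (f : E -> R) := kernel_fun K (fun z => h z * f z).

Let gamma_ge0 : 0 <= gamma.
Proof. by have /andP[/le_trans] := h_itv point; apply. Qed.

Lemma bounded_measurable_step f : bounded_measurable f ->
  bounded_measurable (q f).
Proof.
by move=> bf; apply: bounded_measurable_kernel_fun; exact: bounded_measurableM.
Qed.

Lemma Rintegral_step f : bounded_measurable f ->
  \int[mu]_x q f x = \int[nu]_x f x.
Proof.
by move=> bf; rewrite Rintegral_stationary ?hnu//; exact: bounded_measurableM.
Qed.

(** Jensen leaves $h^p |f|^p$ under the kernel, with $p = 2^i$: $p-1$ of the factors $h$ are bounded
    by [gamma], and the last one is kept as the weight of [q]. *)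
Lemma normX_step_le f i x : bounded_measurable f ->
  `|q f x| ^+ (2 ^ i)%N <=
    gamma ^+ (2 ^ i).-1 * q (fun z => `|f z| ^+ (2 ^ i)%N) x.
Proof.
move=> bf; have K1 := prob_kernel (s := K) x.
have bhf := bounded_measurableM bh bf.
have bhn := bounded_measurableM bh (bounded_measurable_normX (2 ^ i) bf).
apply: le_trans (normX_Rintegral_le i K1 bhf) _.
rewrite -RintegralZl//; last exact: bounded_measurable_integrable K1 bhn.
apply: le_Rintegral => //.
- exact: bounded_measurable_integrable K1 (bounded_measurable_normX _ bhf).
- exact: bounded_measurable_integrable K1
    (bounded_measurableM (bounded_measurable_cst _) bhn).
move=> z _; have /andP[h0 hg] := h_itv z.
rewrite normrM (ger0_norm h0) exprMn mulrA ler_wpM2r ?exprn_ge0//.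
rewrite -{1}(@prednK (2 ^ i)) ?expn_gt0// exprSr ler_wpM2r//.
by rewrite lerXn2r// nnegrE.
Qed.

Lemma norm1_step_le f : bounded_measurable f ->
  \int[mu]_x `|q f x| <= \int[nu]_x `|f x|.
Proof.
move=> bf; have mu1 := probability_setT mu.
(* The exponent 1 is computed away, so this is a fact about $|f|$ itself. *)
have bn := bounded_measurable_normX 1 bf.
rewrite -(Rintegral_step bn); apply: le_Rintegral => //.
- exact: bounded_measurable_integrable mu1
    (bounded_measurable_normX 1 (bounded_measurable_step bf)).
- exact: bounded_measurable_integrable mu1 (bounded_measurable_step bn).
by move=> x _; have := normX_step_le 0 x bf; rewrite expr0 mul1r.
Qed.

Hypothesis beta1 : beta <= 1.
Hypothesis hL2 : forall f, bounded_measurable f ->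
  \int[mu]_x (`|q f x| ^+ 2) <=
    alpha * \int[nu]_x (`|f x| ^+ 2) + beta * (\int[nu]_x f x) ^+ 2.

Lemma norm2X_step_le f i : bounded_measurable f ->
  \int[mu]_x (`|q f x| ^+ (2 ^ i.+1)%N) <=
    gamma ^+ (2 ^ i.+1 - 2) *
      (alpha * \int[nu]_x (`|f x| ^+ (2 ^ i.+1)%N) +
       (\int[nu]_x (`|f x| ^+ (2 ^ i)%N)) ^+ 2).
Proof.
move=> bf; have mu1 := probability_setT mu.
have bn := bounded_measurable_normX (2 ^ i) bf.
have bq := bounded_measurable_step bf.
have bqn := bounded_measurable_normX 2 (bounded_measurable_step bn).
have -> : (2 ^ i.+1 - 2 = (2 ^ i).-1 * 2)%N by rewrite expnSr -subn1 mulnBl.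
set G := gamma ^+ (_ * _).
have G0 : 0 <= G by rewrite exprn_ge0.
(* The pointwise bound is squared, which doubles the exponent of [gamma] to $2(2^i-1)$; the $L_2$
   hypothesis then applies to $|f|^{2^i}$. *)
apply: (@le_trans _ _
    (G * \int[mu]_x (`|q (fun z => `|f z| ^+ (2 ^ i)%N) x| ^+ 2))).
  rewrite -RintegralZl//; last exact: bounded_measurable_integrable mu1 bqn.
  apply: le_Rintegral => //.
  - exact: bounded_measurable_integrable mu1 (bounded_measurable_normX _ bq).
  - exact: bounded_measurable_integrable mu1
      (bounded_measurableM (bounded_measurable_cst _) bqn).
  move=> x _; rewrite expnSr exprM /G exprM -exprMn.
  apply: lerXn2r; rewrite ?nnegrE ?mulr_ge0 ?exprn_ge0//.
  apply: le_trans (normX_step_le i x bf) _.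
  by rewrite ler_wpM2l ?exprn_ge0// ler_norm.
rewrite ler_wpM2l//; apply: le_trans (hL2 bn) _; apply: lerD.
  rewrite le_eqVlt; apply/orP; left; apply/eqP; congr (_ * _).
  by apply: eq_Rintegral => x _; rewrite normrX normr_id -exprM expnSr.
(* This is where $\beta \le 1$ enters. *)
by rewrite -[leRHS]mul1r ler_wpM2r// sqr_ge0.
Qed.

End PropagatorStep.

(** * The constant $\delta(2^r)$: recursion, lower bound 1, and the strict upper bound *)

Section Delta.
Context {R : realType}.
Variables (alpha gamma : R).
Hypotheses (alpha_gt0 : 0 < alpha) (gamma_gt1 : 1 < gamma).

Let gamma_gt0 : 0 < gamma. Proof. exact: lt_trans ltr01 gamma_gt1. Qed.

Let gamma_neq0 : gamma != 0. Proof. exact: lt0r_neq0. Qed.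

Lemma powR2_opp_pred m : 2 `^ (- (m.+1%:R - 1)) = 2 ^- m :> R.
Proof. by rewrite -[m.+1%:R]natr1 addrK powR_invn. Qed.

Lemma powR2_opp_pred0 : 2 `^ (- (0%:R - 1)) = 2 :> R.
Proof. by rewrite sub0r opprK powRr1. Qed.

Lemma invX2_itv m : 0 < (2 ^- m : R) <= 1.
Proof.
rewrite invr_gt0 exprn_gt0//= invf_le1 ?exprn_gt0//.
by rewrite exprn_ege1// ler1n.
Qed.

Lemma deltaS m : delta alpha gamma m.+1 = delta alpha gamma m *
  (gamma `^ (1 - 2 ^- m) /
   (1 - alpha * gamma `^ (2 ^+ m.+1 - 2)) `^ (2 ^- m.+1)).
Proof. by rewrite /delta big_nat_recr//= powR2_opp_pred powR_invn. Qed.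

(** The index starts at 1 on purpose: at 0 the real exponent is $-1$, whereas the truncated natural
    one would be 0. *)
Lemma powR_pow2B2 i : gamma `^ (2 ^+ i.+1 - 2) = gamma ^+ (2 ^ i.+1 - 2).
Proof.
rewrite -powR_mulrn ?ltW// natrB ?natrX//.
by rewrite expnS leq_pmulr// expn_gt0.
Qed.

Lemma alpha_powR_le i j : (i <= j)%N ->
  alpha * gamma `^ (2 ^+ i - 2) <= alpha * gamma `^ (2 ^+ j - 2).
Proof.
move=> ij; rewrite ler_pM2l//; apply: ler_powR; first exact: ltW.
by rewrite lerB// ler_weXn2l// ler1n.
Qed.

(** Each factor has numerator at least 1 and denominator at most 1. *)
Lemma delta_ge1 r : alpha * gamma `^ (2 ^+ r - 2) < 1 ->
  1 <= delta alpha gamma r.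
Proof.
elim: r => [|r IH] hr; first by rewrite /delta big_geq.
rewrite deltaS mulr_ege1//; first by apply: IH; apply: le_lt_trans hr; exact: alpha_powR_le.
have /andP[e0 e1] := invX2_itv r; have /andP[s0 s1] := invX2_itv r.+1.
set y := 1 - alpha * _; have y0 : 0 < y by rewrite subr_gt0.
have y1 : y <= 1 by rewrite gerBl mulr_ge0 ?powR_ge0// ltW.
rewrite ler_pdivlMr ?powR_gt0// mul1r (@le_trans _ _ 1)//.
  by rewrite -[leRHS](powRr0 y); apply: ger_powR; [rewrite y0|exact: ltW].
by rewrite -[leLHS](powRr0 gamma); apply: ler_powR; rewrite ?subr_ge0// ltW.
Qed.

(** Turns the product formula into the fixed-point recursion: raising to the power $2^{r+1}$ takes
    the exponent $1-2^{-r}$ of [gamma] to $2^{r+1}-2$ and that of the denominator to 1. *)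
Lemma deltaS_pow2 r : alpha * gamma `^ (2 ^+ r.+1 - 2) < 1 ->
  delta alpha gamma r.+1 ^+ (2 ^ r.+1) =
    (delta alpha gamma r ^+ (2 ^ r)) ^+ 2 * gamma ^+ (2 ^ r.+1 - 2)
      / (1 - alpha * gamma ^+ (2 ^ r.+1 - 2)).
Proof.
move=> hr; rewrite deltaS exprMn -exprM -expnSr -mulrA; congr (_ * _).
rewrite -powR_pow2B2; set y := 1 - alpha * _; have y0 : 0 <= y by rewrite subr_ge0 ltW.
rewrite expr_div_n -(powR_mulrn _ (powR_ge0 gamma _)).
rewrite -(powR_mulrn _ (powR_ge0 y _)) -!powRrM natrX; congr (_ `^ _ / _).
  have z0 : (2 ^+ r : R) != 0 by rewrite expf_neq0.
  by rewrite exprS; move: (2 ^+ r) z0 => z z0; field.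
by rewrite mulVf ?expf_neq0// powRr1.
Qed.

(** The bases $1-\alpha\gamma^{2^i-2}$ decrease in $i$, so [D] bounds from below all those with $i
    \le r$. What remains are two sums of exponents up to [m]: $\sum (1-2^{-(i-1)}) = m-2+2^{-(m-1)}$
    for [gamma] and $\sum 2^{-i} = 1-2^{-m}$ for [D]. Here [r] stays fixed while [m] varies by
    induction. *)
Lemma delta_le D r m : 0 < D <= 1 ->
  D <= 1 - alpha * gamma `^ (2 ^+ r - 2) -> (m <= r)%N ->
  delta alpha gamma m <=
    gamma `^ (m%:R - 2 + 2 `^ (- (m%:R - 1))) / D `^ (1 - 2 ^- m).
Proof.
move=> /andP[D0 D1] hD; elim: m => [_|m IH mr].
  rewrite /delta big_geq// powR2_opp_pred0 expr0 invr1 subrr.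
  by rewrite [_ - 2 + 2]subrK !powRr0 divr1.
have /andP[e0 e1] := invX2_itv m; have /andP[s0 s1] := invX2_itv m.+1.
have -> : 2 `^ (- (m.+1%:R - 1)) = 2 ^- m :> R by exact: powR2_opp_pred.
rewrite deltaS.
have -> : m.+1%:R - 2 + 2 ^- m =
    (m%:R - 2 + 2 `^ (- (m%:R - 1))) + (1 - 2 ^- m) :> R.
  (* At $m = 0$ the term $2^{-(m-1)}$ equals 2, which is not an inverse power of two. *)
  case: m {IH mr e0 e1 s0 s1} => [|m]; first by rewrite powR2_opp_pred0 expr0; lra.
  rewrite powR2_opp_pred exprS invfM -(natr1 m.+1); set z := (2 ^+ m)^-1; lra.
have -> : 1 - 2 ^- m.+1 = (1 - 2 ^- m) + 2 ^- m.+1 :> R.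
  by rewrite exprS invfM; set z := (2 ^+ m)^-1; lra.
rewrite [gamma `^ (_ + (1 - _))]powRD ?gamma_neq0 ?implybT//.
rewrite [D `^ (_ + _)]powRD ?(gt_eqF D0) ?implybT//.
rewrite invfM mulrACA; set y := 1 - alpha * gamma `^ (2 ^+ m.+1 - 2).
have Dy : D <= y by rewrite (le_trans hD)// lerB// alpha_powR_le.
have y0 : 0 < y by exact: lt_le_trans Dy.
apply: ler_pM.
- by apply: prodr_ge0 => i _; rewrite mulr_ge0 ?invr_ge0 ?powR_ge0.
- by rewrite mulr_ge0 ?invr_ge0 ?powR_ge0.
- by apply: IH; exact: ltnW.
rewrite ler_wpM2l ?powR_ge0// lef_pV2 ?posrE ?powR_gt0//.
by rewrite ge0_ler_powR ?nnegrE// ltW.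
Qed.

Lemma delta_lt r : alpha * gamma `^ (2 ^+ r - 2) < 1 ->
  delta alpha gamma r <
    gamma `^ (r%:R - 2 + 2 `^ (- (r%:R - 1)))
      / (1 - alpha * gamma `^ (2 ^+ r - 2)).
Proof.
move=> hr; set D := 1 - _.
have D0 : 0 < D by rewrite subr_gt0.
have D1 : D < 1 by rewrite gtrBl mulr_gt0 ?powR_gt0.
have /andP[e0 e1] := invX2_itv r.
apply: (le_lt_trans (@delta_le D r r _ _ _)) => //; first by rewrite D0 ltW.
rewrite ltr_pM2l ?powR_gt0// ltf_pV2 ?posrE ?powR_gt0//.
(* Strictness comes from the spare factor $D^{2^{-r}}$, which is below 1 because $D < 1$. *)
have {1}-> : D = D `^ (1 - 2 ^- r) * D `^ (2 ^- r).
  by rewrite -powRD ?subrK ?powRr1 ?(gt_eqF D0) ?implybT ?ltW.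
rewrite gtr_pMr ?powR_gt0// -[ltRHS](congr1 (@^~ (2 ^- r)) (powR1 R)).
by rewrite gt0_ltr_powR ?nnegrE// ltW.
Qed.

End Delta.

(** * Iterating the step along $\hat q_{j,k}$ *)

Lemma qhat_ltn (d : measure_display) (E : measurableType d) (R : realType)
    (mu : nat -> probability E R) (K : nat -> R.-pker E ~> E)
    (g : nat -> E -> R) (j k : nat) (f : E -> R) : (j < k)%N ->
  qhat mu K g j k f = qhat_step mu K g j.+1 (qhat mu K g j.+1 k f).
Proof. by move=> jk; rewrite /qhat big_ltn. Qed.

Lemma qhat_id (d : measure_display) (E : measurableType d) (R : realType)
    (mu : nat -> probability E R) (K : nat -> R.-pker E ~> E)
    (g : nat -> E -> R) (k : nat) (f : E -> R) : qhat mu K g k k f = f.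
Proof. by rewrite /qhat big_geq. Qed.

Section Propagator.
Context {d : measure_display} {E : measurableType d} {R : realType}.
Variables (n : nat) (mu : nat -> probability E R) (K : nat -> R.-pker E ~> E).
Variables (g : nat -> E -> R) (alpha beta gamma : R).
Hypothesis hK : forall k, (1 <= k <= n)%N -> stationary (mu k) (K k).
Hypothesis hgB : forall k, (1 <= k <= n)%N -> bounded_measurable (g k).
Hypothesis hgpos : forall k x, (1 <= k <= n)%N -> 0 < g k x.
Hypothesis hmu : forall k f, (1 <= k <= n)%N -> bounded_measurable f ->
  \int[mu k]_x f x =
    (\int[mu k.-1]_x (g k x * f x)) / (\int[mu k.-1]_x g k x).
Hypothesis hgamma : 1 < gamma.
Hypothesis hgbar : forall k x, (1 <= k <= n)%N -> gbar mu g k x <= gamma.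
Hypothesis halpha : 0 < alpha.
Hypothesis hbeta : beta <= 1.
Hypothesis hL2 : forall k f, (2 <= k <= n)%N -> bounded_measurable f ->
  ('N[mu k.-1]_2%:E[EFin \o qhat_step mu K g k f] ^+ 2
   <= alpha%:E * 'N[mu k]_2%:E[EFin \o f] ^+ 2
      + (beta * (\int[mu k]_x f x)%R ^+ 2)%:E)%E.

Lemma bounded_measurable_gbar k : (1 <= k <= n)%N ->
  bounded_measurable (gbar mu g k).
Proof.
move=> hk.
exact: bounded_measurableM (hgB hk) (bounded_measurable_cst _).
Qed.

Lemma gbar_itv k x : (1 <= k <= n)%N -> 0 <= gbar mu g k x <= gamma.
Proof.
move=> hk; rewrite hgbar// andbT divr_ge0//; first exact/ltW/hgpos.
by apply: Rintegral_ge0 => y _; exact/ltW/hgpos.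
Qed.

Lemma bounded_measurable_qhat_step k f : (1 <= k <= n)%N ->
  bounded_measurable f -> bounded_measurable (qhat_step mu K g k f).
Proof.
by move=> hk bf; apply: bounded_measurable_step => //; exact: bounded_measurable_gbar.
Qed.

(** $\overline g_{k-1,k}$ is the density of $\mu_k$ with respect to $\mu_{k-1}$, since its
    normalising constant leaves the integral. *)
Lemma Rintegral_gbar k f : (1 <= k <= n)%N -> bounded_measurable f ->
  \int[mu k.-1]_x (gbar mu g k x * f x) = \int[mu k]_x f x.
Proof.
move=> hk bf; rewrite [RHS]hmu// /gbar.
have bgf := bounded_measurableM (hgB hk) bf.
rewrite -RintegralZr//; last first.
  exact: bounded_measurable_integrable (probability_setT _) bgf.
by apply: eq_Rintegral => x _; rewrite mulrAC.
Qed.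

Lemma Rintegral_normX2_qhat_step k f : (2 <= k <= n)%N ->
  bounded_measurable f ->
  \int[mu k.-1]_x (`|qhat_step mu K g k f x| ^+ 2) <=
    alpha * \int[mu k]_x (`|f x| ^+ 2) + beta * (\int[mu k]_x f x) ^+ 2.
Proof.
move=> /andP[k2 kn] bf; have k1 : (1 <= k <= n)%N by rewrite ltnW.
have bq := bounded_measurable_qhat_step k1 bf.
have := @hL2 k f; rewrite k2 kn => /(_ isT bf).
by rewrite !Lnorm2_sqr//; exact: probability_setT.
Qed.

Lemma bounded_measurable_qhat j k f : (j <= k <= n)%N ->
  bounded_measurable f -> bounded_measurable (qhat mu K g j k f).
Proof.
move=> /andP[jk kn] bf; move: jk.
elim: (k - j)%N {-2}j (erefl (k - j)%N) => [|m IH] {}j.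
  move=> /eqP; rewrite subn_eq0 => kj jk.
  by rewrite (_ : j = k) ?qhat_id//; apply/eqP; rewrite eqn_leq jk.
move=> kj jk; have {}jk : (j < k)%N by rewrite -subn_gt0 kj.
rewrite qhat_ltn//; apply: bounded_measurable_qhat_step.
  by rewrite /= (leq_trans jk).
by apply: IH => //; rewrite subnS kj.
Qed.

(** Two nested inductions: on [i], doubling the exponent, and inside each level on $k-j$, prepending
    one step. The starting index must vary in the outer hypothesis as well, since the inner step
    calls it at $j+1$. *)
Lemma Rintegral_normX_qhat_le i j k f :
  alpha * gamma `^ (2 ^+ i - 2) < 1 ->
  (1 <= j)%N -> (j <= k <= n)%N -> bounded_measurable f ->
  \int[mu j]_x (`|qhat mu K g j k f x| ^+ (2 ^ i)) <=
    delta alpha gamma i ^+ (2 ^ i) * \int[mu k]_x (`|f x| ^+ (2 ^ i)).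
Proof.
move=> + j1 /andP[+ kn] bf.
elim: i j j1 => [|i IHi] j0 j01 hi.
  (* Exponent 1: the product is empty and the $L_1$ contractions compose. *)
  rewrite /delta big_geq// expr1n mul1r.
  elim: (k - j0)%N {-2}j0 (erefl (k - j0)%N) j01 => [|m IH] {hi}j kj j1 jk.
    move/eqP: kj; rewrite subn_eq0 => kj.
    by rewrite (_ : j = k) ?qhat_id//; apply/eqP; rewrite eqn_leq jk.
  have {}jk : (j < k)%N by rewrite -subn_gt0 kj.
  have jn : (j < n)%N by exact: leq_trans kn.
  apply: le_trans (IH j.+1 _ _ _) => //; last by rewrite subnS kj.
  rewrite qhat_ltn//; apply: norm1_step_le.
  - by apply: hK; rewrite j1 ltnW.
  - exact: bounded_measurable_gbar.
  - by move=> x; exact: gbar_itv.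
  - by move=> h bh; exact: (@Rintegral_gbar j.+1).
  - by apply: bounded_measurable_qhat => //; rewrite jk.
have hi' : alpha * gamma `^ (2 ^+ i - 2) < 1.
  by apply: le_lt_trans hi; exact: alpha_powR_le.
set D := delta alpha gamma i ^+ (2 ^ i).
have D1 : 1 <= D by rewrite exprn_ege1// delta_ge1.
have D0 : 0 <= D := le_trans ler01 D1.
rewrite deltaS_pow2// -/D; set G := gamma ^+ _.
have G1 : 1 <= G by rewrite exprn_ege1// ltW.
have aG : 0 < 1 - alpha * G by rewrite subr_gt0 /G -powR_pow2B2.
(* By [deltaS_pow2] this is $\delta(2^{i+1})^{2^{i+1}}$; [D'E] is its fixed-point equation. *)
set D' := _ / _.
have D'E : G * (alpha * D' + D ^+ 2) = D'.
  by rewrite /D'; field; rewrite gt_eqF.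
have mk1 := probability_setT (mu k).
have bfi := bounded_measurable_normX (2 ^ i) bf.
have fi0 : 0 <= \int[mu k]_x (`|f x| ^+ (2 ^ i.+1)).
  by apply: Rintegral_ge0 => x _; exact: exprn_ge0.
have f2 : (\int[mu k]_x (`|f x| ^+ (2 ^ i))) ^+ 2 <=
    \int[mu k]_x (`|f x| ^+ (2 ^ i.+1)).
  rewrite expnSr; under [leRHS]eq_Rintegral do rewrite exprM.
  exact: sqr_Rintegral_le.
elim: (k - j0)%N {-2}j0 (erefl (k - j0)%N) j01 => [|m IH] j kj j1 jk.
  move/eqP: kj; rewrite subn_eq0 => kj.
  rewrite (_ : j = k) ?qhat_id//; last by apply/eqP; rewrite eqn_leq jk.
  (* For $j = k$ the claim is $D' \ge 1$: the numerator $D^2 G$ is at least 1 and the denominator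
     $1-\alpha G$ at most 1. *)
  rewrite ler_peMl// /D' ler_pdivlMr// mul1r.
  apply: (@le_trans _ _ 1); last by rewrite mulr_ege1// exprn_ege1.
  by rewrite gerBl mulr_ge0 ?ltW// (lt_le_trans ltr01).
have {}jk : (j < k)%N by rewrite -subn_gt0 kj.
have jn : (j < n)%N by exact: leq_trans kn.
have bq : bounded_measurable (qhat mu K g j.+1 k f).
  by apply: bounded_measurable_qhat => //; rewrite jk.
rewrite qhat_ltn//.
have jk1 : (1 <= j.+1 <= n)%N by [].
(* The $L_2$ hypothesis starts at index 2, which is why $j \ge 1$ is required. *)
have jk2 : (2 <= j.+1 <= n)%N by rewrite ltnS j1.
have step := norm2X_step_le (bounded_measurable_gbar jk1)
  (fun x => @gbar_itv j.+1 x jk1)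
  hbeta (fun h => @Rintegral_normX2_qhat_step j.+1 h jk2) i bq.
apply: le_trans step _.
rewrite -/G -D'E -mulrA ler_wpM2l ?(le_trans ler01)// mulrDl -mulrA.
(* The [alpha] term is handled by the inner hypothesis; the squared lower-order term by the outer
   one, followed by [f2] to return to the exponent $2^{i+1}$. *)
apply: lerD.
  apply: ler_wpM2l; first exact: ltW.
  by apply: IH => //; rewrite subnS kj.
apply: (@le_trans _ _ (D ^+ 2 * (\int[mu k]_x (`|f x| ^+ (2 ^ i))) ^+ 2)).
  rewrite -exprMn; apply: lerXn2r; last exact: IHi.
  - by rewrite nnegrE Rintegral_ge0// => x _; exact: exprn_ge0.
  - by rewrite nnegrE mulr_ge0// Rintegral_ge0// => x _; exact: exprn_ge0.
by rewrite ler_wpM2l// exprn_ge0.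
Qed.

(** Taking $2^r$-th roots in the integral bound. *)
Lemma Lnorm_qhat_le r j k f : alpha * gamma `^ (2 ^+ r - 2) < 1 ->
  (1 <= j)%N -> (j <= k <= n)%N -> bounded_measurable f ->
  ('N[mu j]_((2 ^ r)%N%:R)%:E[EFin \o qhat mu K g j k f]
   <= (delta alpha gamma r)%:E * 'N[mu k]_((2 ^ r)%N%:R)%:E[EFin \o f])%E.
Proof.
move=> hr j1 jk bf; have p0 : (0 < 2 ^ r)%N by rewrite expn_gt0.
have bq := bounded_measurable_qhat jk bf.
rewrite !LnormX//; [|exact: probability_setT..]; rewrite -EFinM lee_fin.
have d1 : 1 <= delta alpha gamma r by exact: delta_ge1.
have d0 : 0 <= delta alpha gamma r by rewrite (le_trans ler01).
have pos m h : 0 <= \int[mu m]_x (`|h x| ^+ (2 ^ r)).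
  by apply: Rintegral_ge0 => x _; exact: exprn_ge0.
apply: (@le_trans _ _ ((delta alpha gamma r ^+ (2 ^ r) *
    \int[mu k]_x (`|f x| ^+ (2 ^ r))) `^ (2 ^ r)%:R^-1)).
  apply: ge0_ler_powR; rewrite ?nnegrE ?invr_ge0 ?mulr_ge0 ?exprn_ge0//.
  exact: Rintegral_normX_qhat_le.
by rewrite powRM ?exprn_ge0// -powR_mulrn// -powRrM mulfV ?powRr1.
Qed.

End Propagator.

Theorem theorem4p5 (R : realType) (E : ptopologicalType) (hE : polish R E)
    (n : nat)
    (mu : nat -> probability (borelType E) R)
    (K : nat -> R.-pker (borelType E) ~> (borelType E))
    (g : nat -> borelType E -> R)
    (hK : forall k : nat, (1 <= k <= n)%N -> stationary (mu k) (K k))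
    (hgB : forall k : nat, (1 <= k <= n)%N -> bounded_measurable (g k))
    (hgpos : forall (k : nat) (x : borelType E),
       (1 <= k <= n)%N -> 0 < g k x)
    (hmu : forall (k : nat) (f : borelType E -> R),
       (1 <= k <= n)%N -> bounded_measurable f ->
       \int[mu k]_x f x =
         (\int[mu k.-1]_x (g k x * f x)) / (\int[mu k.-1]_x g k x))
    (r p : nat) (hp : p = (2 ^ r)%N)
    (gamma alpha beta : R)
    (hgamma : 1 < gamma)
    (hgbar : forall (k : nat) (x : borelType E),
       (1 <= k <= n)%N -> gbar mu g k x <= gamma)
    (halpha : 0 < alpha < 1)
    (hbeta : 0 <= beta <= 1)
    (hL2 : forall (k : nat) (f : borelType E -> R),
       (2 <= k <= n)%N -> bounded_measurable f ->
       ('N[mu k.-1]_2%:E[EFin \o qhat_step mu K g k f] ^+ 2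
        <= alpha%:E * 'N[mu k]_2%:E[EFin \o f] ^+ 2
           + (beta * (\int[mu k]_x f x)%R ^+ 2)%:E)%E)
    (hag : alpha * gamma `^ (p%:R - 2) < 1) :
  (forall (j k : nat) (f : borelType E -> R),
     (1 <= j)%N -> (j < k)%N -> (k <= n)%N -> bounded_measurable f ->
     ('N[mu j]_(p%:R)%:E[EFin \o qhat mu K g j k f]
      <= (delta alpha gamma r)%:E * 'N[mu k]_(p%:R)%:E[EFin \o f])%E) /\
  delta alpha gamma r
    < gamma `^ (r%:R - 2 + 2 `^ (- (r%:R - 1)))
      / (1 - alpha * gamma `^ (2 ^+ r - 2)).
Proof.
have /andP[a0 a1] := halpha; have /andP[b0 b1] := hbeta.
have hr : alpha * gamma `^ (2 ^+ r - 2) < 1 by rewrite -natrX -hp.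
split; last exact: delta_lt.
move=> j k f j1 jk kn bf; rewrite hp.
by apply: (Lnorm_qhat_le hK hgB hgpos hmu hgamma hgbar a0 b1 hL2 hr); rewrite ?(ltnW jk).
Qed.
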